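(* Let $R$ be a ring. Then $\mathbb{AG}(R)$ is (isomorphic to) a graph $K_3(3)$ if and only if $R\cong F_1\times F_2\times F_3$, where $F_1,F_2,F_3$ are fields.
   Context: All rings are commutative with identity. The annihilating-ideal graph $\mathbb{AG}(R)$ of a ring $R$ is the simple graph whose vertices are the nonzero ideals $I$ of $R$ for which there exists a nonzero ideal $J$ of $R$ with $IJ=0$; distinct vertices $I,J$ are adjacent iff $IJ=0$. $K_3(3)$ denotes a graph consisting of a triangle $K_3$ together with three horns, one attached to each of the three vertices of the triangle; here a horn attached to a vertex $a$ is a nonempty set (of arbitrary, finite or infinite, cardinality) of new vertices of degree $1$, each adjacent only to $a$. The sizes of the horns are arbitrary and not recorded in the notation. *)

(* Defs.v *)
From HB Require Import structures.
From mathcomp Require Import all_boot all_algebra.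
From mathcomp Require Import boolp classical_sets.

Set Implicit Arguments.
Unset Strict Implicit.
Unset Printing Implicit Defensive.

Import GRing.Theory.

Local Open Scope classical_set_scope.
Local Open Scope ring_scope.

(* The vertex type is arbitrary, so that infinite graphs are allowed. *)
Record sgraph := SGraph {
  vertex :> Type;
  adj : vertex -> vertex -> Prop;
  adj_sym : forall x y, adj x y -> adj y x;
  adj_irrefl : forall x, ~ adj x x }.

Definition sgraph_iso (G H : sgraph) : Prop :=
  exists f : G -> H, bijective f /\ forall x y : G, adj x y <-> adj (f x) (f y).

(* Ideals are the submodules of the regular module R^o; unlike [idealr_closed],
   this does not require them to be proper. *)
Definition is_ideal (R : comPzRingType) (I : set R) : Prop :=
  submod_closed ([in I] : {pred R^o}).

Lemma is_idealP (R : comPzRingType) (I : set R) :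
  is_ideal I <->
  [/\ I 0, forall x y, I x -> I y -> I (x + y) & forall a x, I x -> I (a * x)].
Proof.
split=> [[/set_mem I0 Ilin]|[I0 ID IM]]; last first.
  split=> [|a x y /set_mem Ix /set_mem Iy]; apply: mem_set => //.
  by apply: ID => //; apply: IM.
split=> // [x y Ix Iy|a x Ix]; apply: set_mem.
  by have := Ilin 1 x y (mem_set Ix) (mem_set Iy); rewrite scale1r.
by have := Ilin a x 0 (mem_set Ix) (mem_set I0); rewrite addr0.
Qed.

Definition ideal_prod (R : comPzRingType) (I J : set R) : set R :=
  [set x | exists s : seq (R * R),
     (forall p, p \in s -> I p.1 /\ J p.2) /\ x = \sum_(p <- s) p.1 * p.2].

Lemma ideal_prodC (R : comPzRingType) (I J : set R) :
  ideal_prod I J = ideal_prod J I.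
Proof.
suff sub (A B : set R) : ideal_prod A B `<=` ideal_prod B A.
  by apply/seteqP; split; apply: sub.
move=> x [s [sAB ->]]; exists [seq (p.2, p.1) | p <- s]; split.
  by move=> _ /mapP[p /sAB[Ap Bp] ->].
by rewrite big_map; apply: eq_bigr => p _; rewrite mulrC.
Qed.

Definition annihilating (R : comPzRingType) (I : set R) : Prop :=
  [/\ is_ideal I, I <> [set 0] &
      exists J : set R, [/\ is_ideal J, J <> [set 0] & ideal_prod I J = [set 0]]].

Section AnnihilatingIdealGraph.
Variable R : comPzRingType.

Definition AG_vertex := {I : set R | annihilating I}.

Definition AG_adj (I J : AG_vertex) : Prop :=
  I <> J /\ ideal_prod (sval I) (sval J) = [set 0].

Lemma AG_adj_sym I J : AG_adj I J -> AG_adj J I.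
Proof. by case=> neq IJ0; split; [exact: nesym | rewrite ideal_prodC]. Qed.

Lemma AG_adj_irrefl I : ~ AG_adj I I.
Proof. by case. Qed.

Definition AG : sgraph := SGraph AG_adj_sym AG_adj_irrefl.

End AnnihilatingIdealGraph.

(* The triangle on 'I_3 with a horn [horn i] attached to each vertex i:
   [inl i] is a vertex of the triangle, [inr (existT i h)] is the vertex h of
   the horn at i. *)
Section HornedTriangle.
Variable horn : 'I_3 -> Type.

Definition K33_vertex : Type := ('I_3 + {i : 'I_3 & horn i})%type.

Definition K33_adj (x y : K33_vertex) : Prop :=
  match x, y with
  | inl i, inl j => i <> j
  | inl i, inr h => i = projT1 h
  | inr h, inl i => i = projT1 h
  | inr _, inr _ => False
  end.

Lemma K33_adj_sym x y : K33_adj x y -> K33_adj y x.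
Proof. by case: x y => [i|h] [j|k] //=; apply: nesym. Qed.

Lemma K33_adj_irrefl x : ~ K33_adj x x.
Proof. by case: x => [i|h] //=. Qed.

Definition K33_graph : sgraph := SGraph K33_adj_sym K33_adj_irrefl.

End HornedTriangle.

Definition is_K33 (G : sgraph) : Prop :=
  exists horn : 'I_3 -> Type,
    (forall i, inhabited (horn i)) /\ sgraph_iso G (K33_graph horn).

Definition ring_iso (R S : pzRingType) : Prop :=
  exists f : {rmorphism R -> S}, bijective f.

(* Main.v *)
Require Import Defs.
From HB Require Import structures.
From mathcomp Require Import all_boot all_algebra.
From mathcomp Require Import boolp classical_sets.

Set Implicit Arguments.
Unset Strict Implicit.
Unset Printing Implicit Defensive.

Import GRing.Theory.

Local Open Scope classical_set_scope.
Local Open Scope ring_scope.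

(** Both sides of the equivalence say that [1] is a sum of three orthogonal
idempotents [e i], each generating a minimal ideal; call such a family a
decomposition.

A product of three fields has the decomposition given by the standard basis.
Conversely, if [e] is an idempotent generating a minimal ideal then the corner
[R e] is a field with identity [e], and sending [x] to the triple of the
[x * e i] identifies [R] with the product of the three corners
([ring_iso_corners]).

Given a decomposition, an ideal is determined by the set of those [i] for which
it contains [e i], so that there are eight ideals, and two of them annihilate
each other exactly when their index sets are disjoint ([support_ideal]). The
vertices are the six nonempty proper subsets of the index set: the singletons
form the triangle, and the complement of [{i}] is a horn attached to [{i}],
since it meets every other singleton and every other complement of a singleton.

To obtain a decomposition from the graph, let [T i] be the vertices of the triangle and [P i] a horn
attached to [T i]. Two facts are extracted from the graph: a nonzero ideal
annihilating two of the [T i] is one of the [T k] ([horned_triangle]), and [P i]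
annihilates [T j] only for [j = i], which prevents [T j] from being contained in
[T i] for [j <> i]. If [T i] had square zero then [T i + T j] would annihilate
[T i] and the third vertex, so it would be some [T l] containing both [T i] and
[T j], which is impossible. A nonzero ideal inside [T i] annihilates the two
other vertices, hence is again [T i]. So each [T i] is a minimal ideal with nonzero
square and is therefore generated by an idempotent [e i] ([brauer]). Finally
[1 - \sum_i e i] annihilates all the [T i]; were it nonzero, it would generate
one of them, but it is orthogonal to each of the [e i]. *)

(** * Ideals and annihilation *)

Section Ideals.
Variable R : comPzRingType.
Implicit Types (I J : set R) (x y : R).

Definition annihilates I J := forall x y, I x -> J y -> x * y = 0.

Lemma ideal_prod_eq0 I J : is_ideal I -> is_ideal J ->
  ideal_prod I J = [set 0] <-> annihilates I J.
Proof.
move=> /is_idealP[I0 _ _] /is_idealP[J0 _ _]; split=> [IJ0 x y Ix Jy|IJ0].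
  suff : ideal_prod I J (x * y) by rewrite IJ0.
  exists [:: (x, y)]; split; last by rewrite big_seq1.
  by move=> p; rewrite inE => /eqP ->.
apply/seteqP; split=> [z [s [sIJ ->]]|_ ->] /=.
  by rewrite big_seq big1 // => p /sIJ[]; apply: IJ0.
by exists [::]; split=> //; rewrite big_nil.
Qed.

Lemma ideal_neq0P I : is_ideal I -> I <> [set 0] <-> exists2 x, I x & x <> 0.
Proof.
move=> /is_idealP[I0 _ _]; split=> [Inz|[x Ix xnz] Iz]; last first.
  by apply: xnz; move: Ix; rewrite Iz.
apply: contrapT => noI; apply: Inz; apply/seteqP; split=> [x Ix|_ ->//].
by apply: contrapT => xnz; apply: noI; exists x.
Qed.

Definition principal x : set R := [set y | exists a, y = a * x].

Lemma principal_ideal x : is_ideal (principal x).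
Proof.
apply/is_idealP; split=> [|_ _ [a ->] [b ->]|c _ [a ->]].
- by exists 0; rewrite mul0r.
- by exists (a + b); rewrite mulrDl.
- by exists (c * a); rewrite mulrA.
Qed.

Lemma mem_principal x : principal x x.
Proof. by exists 1; rewrite mul1r. Qed.

Lemma principal_neq0 x : x <> 0 -> principal x <> [set 0].
Proof.
move=> xnz; apply/(ideal_neq0P (principal_ideal x)).
by exists x => //; exact: mem_principal.
Qed.

Definition ideal_sum I J : set R := [set z | exists x y, [/\ I x, J y & z = x + y]].

Lemma ideal_sum_ideal I J : is_ideal I -> is_ideal J -> is_ideal (ideal_sum I J).
Proof.
move=> /is_idealP[I0 ID IM] /is_idealP[J0 JD JM]; apply/is_idealP; split.
- by exists 0, 0; rewrite addr0.
- move=> _ _ [x [y [Ix Jy ->]]] [x' [y' [Ix' Jy' ->]]].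
  by exists (x + x'), (y + y'); rewrite addrACA; split; [apply: ID|apply: JD|].
- move=> a _ [x [y [Ix Jy ->]]].
  by exists (a * x), (a * y); rewrite mulrDr; split; [apply: IM|apply: JM|].
Qed.

Lemma ideal_sum_subl I J : is_ideal J -> I `<=` ideal_sum I J.
Proof. by move=> /is_idealP[J0 _ _] x Ix; exists x, 0; rewrite addr0. Qed.

Lemma ideal_sum_subr I J : is_ideal I -> J `<=` ideal_sum I J.
Proof. by move=> /is_idealP[I0 _ _] x Jx; exists 0, x; rewrite add0r. Qed.

End Ideals.

(** * Idempotents generating a minimal ideal *)

Section MinimalIdempotents.
Variable R : comPzRingType.

(** The last field says that the ideal generated by [e] is minimal: every
nonzero multiple of [e] generates it. *)
Record minimal_idempotent (e : R) : Prop := MinimalIdempotent {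
  min_idem : e * e = e;
  min_idem_neq0 : e <> 0;
  min_idem_inv : forall x, x * e <> 0 -> exists y, y * (x * e) = e }.

(** Brauer's lemma. If [x] in [I] does not annihilate [I] then minimality gives
[x I = I], so that [x = x e] for some [e] in [I]. The elements of [I] killed by
[x] form a proper subideal, hence there is only [0], and [e * e - e] is one of
them. *)
Lemma brauer (I : set R) : is_ideal I ->
    (forall K, is_ideal K -> K <> [set 0] -> K `<=` I -> K = I) ->
    ~ annihilates I I ->
  exists2 e, I e & minimal_idempotent e.
Proof.
move=> idI minI I2; have [I0 ID IM] := (is_idealP I).1 idI.
have [x [y [Ix Iy xynz]]] : exists x y, [/\ I x, I y & x * y <> 0].
  apply: contrapT => noxy; apply: I2 => x y Ix Iy.
  by apply: contrapT => xynz; apply: noxy; exists x, y.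
have principalE z : I z -> z <> 0 -> principal z = I.
  move=> Iz znz; apply: minI; first exact: principal_ideal.
    exact: principal_neq0.
  by move=> _ [a ->]; apply: IM.
have [a xE] : principal (x * y) x by rewrite principalE //; apply: IM.
pose e := a * y; have Ie : I e by apply: IM.
have xe : x * e = x by rewrite {2}xE /e mulrCA.
have killx z : I z -> x * z = 0 -> z = 0.
  move=> Iz xz0; apply: contrapT => znz.
  have [b yE] : principal z y by rewrite principalE.
  by apply: xynz; rewrite yE mulrCA xz0 mulr0.
have xnz : x <> 0 by move=> x0; apply: xynz; rewrite x0 mul0r.
exists e => //; split=> [|e0|z zenz].
- apply/eqP; rewrite -subr_eq0; apply/eqP/killx.
    by rewrite -mulN1r; apply: ID; apply: IM.
  by rewrite mulrBr mulrA !xe subrr.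
- by apply: xnz; rewrite -xe e0 mulr0.
- have [b eE] : principal (z * e) e by rewrite principalE //; apply: IM.
  by exists b.
Qed.

Record decomposition n (e : 'I_n -> R) : Prop := Decomposition {
  dec_min : forall i, minimal_idempotent (e i);
  dec_orth : forall i j, i <> j -> e i * e j = 0;
  dec_sum : \sum_i e i = 1 }.

Lemma dec_expand n (e : 'I_n -> R) x : decomposition e -> x = \sum_i x * e i.
Proof. by case=> _ _ s1; rewrite -mulr_sumr s1 mulr1. Qed.

End MinimalIdempotents.

Lemma decomposition_iso (R S : comPzRingType) n (E : 'I_n -> S) :
  ring_iso R S -> decomposition E -> exists e : 'I_n -> R, decomposition e.
Proof.
case=> f [g fK gK] [Emin Eorth Esum]; have finj := can_inj fK.
exists (g \o E); split=> [i|i j ij|] /=; last 2 first.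
- by apply: finj; rewrite rmorphM !gK rmorph0 Eorth.
- by apply: finj; rewrite rmorph1 rmorph_sum -Esum; apply: eq_bigr => i _; rewrite gK.
have [idE Enz Einv] := Emin i; split=> [|e0|x xenz].
- by apply: finj; rewrite rmorphM gK.
- by apply: Enz; rewrite -(gK (E i)) e0 rmorph0.
- have [|y yE] := Einv (f x).
    move=> fx0; apply: xenz; apply: finj.
    by rewrite rmorphM gK rmorph0.
  by exists (g y); apply: finj; rewrite !rmorphM !gK.
Qed.

Lemma decomposition_fields (F1 F2 F3 : fieldType) :
  exists E : 'I_3 -> F1 * F2 * F3, decomposition E.
Proof.
pose E (i : 'I_3) : F1 * F2 * F3 :=
  ((i == 0 :> nat)%:R, (i == 1%N :> nat)%:R, (i == 2%N :> nat)%:R).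
have bnatM (K : fieldType) (b c : bool) : b%:R * c%:R = (b && c)%:R :> K.
  by rewrite -natrM mulnb.
exists E; split=> [i|i j ij|]; last 2 first.
- have disj (k : nat) : (i == k :> nat) && (j == k :> nat) = false.
    by apply/negP => /andP[/eqP ik /eqP jk]; apply: ij; apply: val_inj; rewrite /= ik.
  by congr (_, _, _); rewrite /= bnatM disj.
- rewrite !big_ord_recl big_ord0.
  by congr (_, _, _); rewrite /= ?addr0 ?add0r.
split=> [|Ei0|x xEnz].
- by congr (_, _, _); rewrite /= bnatM andbb.
- have h1 := congr1 (fun x => x.1.1) Ei0; have h2 := congr1 (fun x => x.1.2) Ei0.
  have h3 := congr1 snd Ei0; move: h1 h2 h3.
  by case: (i) => [[|[|[|//]]] ?] /= /eqP h1 /eqP h2 /eqP h3;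
    move: h1 h2 h3; rewrite ?oner_eq0.
- have mulVb (K : fieldType) (a : K) (b : bool) :
      (b -> a != 0) -> a^-1 * (a * b%:R) = b%:R.
    case: b => [/(_ isT) anz|_]; last by rewrite !mulr0.
    by rewrite mulr1 mulVf.
  exists (x.1.1^-1, x.1.2^-1, x.2^-1).
  congr (_, _, _); apply: mulVb => /eqP ik; apply/eqP => xk0; apply: xEnz;
    by congr (_, _, _); rewrite /= ?xk0 ?mul0r // ik mulr0.
Qed.

(** * The field cut out by a minimal idempotent *)

Section Corner.
Variables (R : comPzRingType) (e : R) (min_e : minimal_idempotent e).

Definition corner_pred : {pred R} := [pred x | x * e == x].

Fact corner_zmod_closed : zmod_closed corner_pred.
Proof.
split=> [|x y]; rewrite !inE ?mul0r // => /eqP xe /eqP ye.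
by rewrite mulrBl xe ye.
Qed.
HB.instance Definition _ :=
  GRing.isZmodClosed.Build R corner_pred corner_zmod_closed.

(** The proof of minimality is a parameter of the type so that the field
structure, which depends on it, can be attached to the type. *)
Definition corner of minimal_idempotent e := {x : R | x \in corner_pred}.
Local Notation C := (corner min_e).

HB.instance Definition _ := SubType.on C.
HB.instance Definition _ := [Choice of C by <:].
HB.instance Definition _ := [SubChoice_isSubZmodule of C by <:].

Fact to_corner_subproof x : x * e \in corner_pred.
Proof. by rewrite inE -mulrA min_idem. Qed.

Definition to_corner x : C := Sub (x * e) (to_corner_subproof x).

Lemma val_to_corner x : val (to_corner x) = x * e.
Proof. exact: SubK. Qed.

Lemma cornerP (x : C) : val x * e = val x.
Proof. by have := valP x; rewrite inE => /eqP. Qed.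

Lemma val_cornerD (x y : C) : val (x + y) = val x + val y.
Proof. by []. Qed.

Lemma val_cornerB (x y : C) : val (x - y) = val x - val y.
Proof. by []. Qed.

Lemma valK_corner (x : C) : to_corner (val x) = x.
Proof. by apply: val_inj; rewrite val_to_corner cornerP. Qed.

Definition corner_mul (x y : C) : C := to_corner (val x * val y).

Lemma val_corner_mul x y : val (corner_mul x y) = val x * val y.
Proof. by rewrite val_to_corner -mulrA cornerP. Qed.

Fact corner_mulA : associative corner_mul.
Proof. by move=> x y z; apply: val_inj; rewrite !val_corner_mul mulrA. Qed.
Fact corner_mulC : commutative corner_mul.
Proof. by move=> x y; apply: val_inj; rewrite !val_corner_mul mulrC. Qed.
Fact corner_mul1 : left_id (to_corner 1) corner_mul.
Proof.
by move=> x; apply: val_inj; rewrite val_corner_mul val_to_corner mul1r mulrC cornerP.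
Qed.
Fact corner_mulDl : left_distributive corner_mul +%R.
Proof.
by move=> x y z; apply: val_inj; rewrite val_cornerD !val_corner_mul val_cornerD mulrDl.
Qed.
Fact corner_1neq0 : to_corner 1 != 0.
Proof.
apply/eqP => /(congr1 val); rewrite val_to_corner mul1r raddf0.
exact: min_idem_neq0.
Qed.

HB.instance Definition _ := GRing.Zmodule_isComNzRing.Build C
  corner_mulA corner_mulC corner_mul1 corner_mulDl corner_1neq0.

Lemma val_cornerM (x y : C) : val (x * y) = val x * val y.
Proof. exact: val_corner_mul. Qed.

Lemma val_corner1 : val (1 : C) = e.
Proof. by rewrite -[RHS]mul1r -val_to_corner. Qed.

Fact corner_inv_exists (x : C) :
  exists y : C, (x != 0 -> y * x = 1) /\ (x = 0 -> y = 0).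
Proof.
have [->|xnz] := eqVneq x 0; first by exists 0.
have [|y yx] := min_idem_inv min_e (x := val x).
  by rewrite cornerP => x0; case/eqP: xnz; apply: val_inj; rewrite raddf0.
exists (to_corner y); split=> [_|x0]; last by rewrite x0 eqxx in xnz.
apply: val_inj; rewrite val_cornerM val_corner1 val_to_corner.
by rewrite -mulrA (mulrC e).
Qed.

Definition corner_inv (x : C) : C := projT1 (cid (corner_inv_exists x)).

Fact corner_mulVf x : x != 0 -> corner_inv x * x = 1.
Proof. by rewrite /corner_inv; case: cid => y []. Qed.
Fact corner_inv0 : corner_inv 0 = 0.
Proof. by rewrite /corner_inv; case: cid => y [] /= _ y0; exact: y0. Qed.

HB.instance Definition _ := GRing.ComNzRing_isField.Build C
  corner_mulVf corner_inv0.

Fact to_corner_zmod_morphism : zmod_morphism to_corner.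
Proof.
by move=> x y; apply: val_inj; rewrite val_cornerB !val_to_corner mulrBl.
Qed.
Fact to_corner_monoid_morphism : monoid_morphism to_corner.
Proof.
split=> // x y; apply: val_inj; rewrite val_cornerM !val_to_corner.
by rewrite mulrACA min_idem.
Qed.
HB.instance Definition _ :=
  GRing.isZmodMorphism.Build R C to_corner to_corner_zmod_morphism.
HB.instance Definition _ :=
  GRing.isMonoidMorphism.Build R C to_corner to_corner_monoid_morphism.

End Corner.

(** The inverse adds up the three components: [1] is the sum of the [e i], and
an element of [R e j] has zero component at every other index. *)
Lemma ring_iso_corners (R : comPzRingType) (e : 'I_3 -> R) :
  decomposition e -> exists F1 F2 F3 : fieldType, ring_iso R (F1 * F2 * F3)%type.
Proof.
move=> dece; have [mine orthe sume] := dece.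
pose i0 : 'I_3 := ord0; pose i1 : 'I_3 := lift ord0 ord0.
pose i2 : 'I_3 := lift ord0 (lift ord0 ord0).
pose C i : fieldType := corner (mine i).
exists (C i0), (C i1), (C i2).
pose f (x : R) : C i0 * C i1 * C i2 :=
  (to_corner (mine i0) x, to_corner (mine i1) x, to_corner (mine i2) x).
have fB : zmod_morphism f by move=> x y; rewrite /f !raddfB.
have fM : monoid_morphism f.
  by split=> [|x y]; rewrite /f ?rmorph1 ?rmorphM.
pose fr : {rmorphism R -> (C i0 * C i1 * C i2)%type} :=
  HB.pack f (GRing.isZmodMorphism.Build _ _ f fB)
    (GRing.isMonoidMorphism.Build _ _ f fM).
exists fr; exists (fun y => val y.1.1 + val y.1.2 + val y.2) => [x|[[a b] c]] /=.
  by rewrite [RHS](dec_expand x dece) !big_ord_recl big_ord0 addr0 addrA.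
have other i j (x : C j) : i <> j -> to_corner (mine i) (val x) = 0.
  move=> ij; apply: val_inj.
  by rewrite val_to_corner -cornerP -mulrA orthe ?mulr0 ?raddf0 //; apply: nesym.
by congr (_, _, _); rewrite !raddfD /= valK_corner !other ?addr0 ?add0r.
Qed.

(** * The graph of a ring with a decomposition *)

Section Support.
Variables (R : comPzRingType) (n : nat) (e : 'I_n -> R) (dec_e : decomposition e).
Implicit Types (S : {set 'I_n}) (I : set R).

Definition support_ideal S : set R := [set x | forall i, i \notin S -> x * e i = 0].

Lemma support_ideal_ideal S : is_ideal (support_ideal S).
Proof.
apply/is_idealP; split=> [i _|x y Sx Sy i iS|a x Sx i iS].
- by rewrite mul0r.
- by rewrite mulrDl Sx // Sy // addr0.
- by rewrite -mulrA Sx // mulr0.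
Qed.

Lemma mem_support_ideal S i : support_ideal S (e i) <-> i \in S.
Proof.
split=> [Sei|iS j jS].
  apply/negP => /negP/Sei; rewrite (min_idem (dec_min dec_e i)).
  exact: min_idem_neq0 (dec_min dec_e i).
by apply: (dec_orth dec_e) => ij; rewrite -ij iS in jS.
Qed.

Lemma support_ideal_inj : injective support_ideal.
Proof.
move=> S S' SS'; apply/setP => i; apply/idP/idP => /mem_support_ideal.
  by rewrite SS' => /mem_support_ideal.
by rewrite -SS' => /mem_support_ideal.
Qed.

(** If [x] is in [I] and [x * e i <> 0], then minimality gives [e i] in [I]. *)
Lemma ideal_supportP I : is_ideal I -> exists S, I = support_ideal S.
Proof.
move=> /is_idealP[I0 ID IM]; exists [set i | `[< I (e i) >]]%SET.
apply/seteqP; split=> [x Ix i|x Sx].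
  rewrite inE => /asboolPn nIe; apply: contrapT => xenz; apply: nIe.
  have [y <-] := min_idem_inv (dec_min dec_e i) xenz.
  by apply: (IM); rewrite mulrC; apply: IM.
rewrite (dec_expand x dec_e); apply: (big_ind I) => // i _.
have [/asboolP Ie|nIe] := boolP `[< I (e i) >]; first exact: IM.
by rewrite Sx // inE.
Qed.

Lemma support_ideal_eq0 S : support_ideal S = [set 0] <-> S = finset.set0.
Proof.
split=> [S0|->].
  apply/eqP; rewrite -finset.subset0; apply/fintype.subsetP => i /mem_support_ideal.
  by rewrite S0 => /(min_idem_neq0 (dec_min dec_e i)).
apply/seteqP; split=> [x Sx|x ->] /=.
  by rewrite (dec_expand x dec_e) big1 // => i _; rewrite Sx ?inE.
by move=> i _; rewrite mul0r.
Qed.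

Lemma annihilates_support S S' :
  annihilates (support_ideal S) (support_ideal S') <-> (S :&: S')%SET = finset.set0.
Proof.
split=> [ann|disj x y Sx Sy].
  apply/finset.setP => i; rewrite !inE; apply/negP.
  move=> /andP[/mem_support_ideal iS /mem_support_ideal iS'].
  apply: (min_idem_neq0 (dec_min dec_e i)).
  by rewrite -(min_idem (dec_min dec_e i)) ann.
rewrite (dec_expand (x * y) dec_e) big1 // => i _.
have [iS|iS] := boolP (i \in S); last by rewrite mulrAC Sx // mul0r.
have iS' : i \notin S' by move/finset.setP/(_ i): disj; rewrite !inE iS /= => ->.
by rewrite -mulrA Sy ?mulr0.
Qed.

Lemma annihilating_support S :
  annihilating (support_ideal S) <-> S != finset.set0 /\ S != [set: _]%SET.
Proof.
have idS := support_ideal_ideal.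
split=> [[_ Snz [J [idJ]]]|[Snz SnT]].
  have [S' ->] := ideal_supportP idJ.
  rewrite support_ideal_eq0 ideal_prod_eq0 // annihilates_support => S'nz disj.
  split; first by apply/eqP => S0; apply/Snz/support_ideal_eq0.
  apply/eqP => ST; apply: S'nz; apply/eqP; rewrite -finset.subset0.
  by rewrite -disj ST finset.setTI.
split=> //; first by rewrite support_ideal_eq0; apply/eqP.
exists (support_ideal (~: S)%SET); split=> //.
  rewrite support_ideal_eq0 => /(congr1 (@finset.setC _)).
  by rewrite finset.setCK finset.setC0 => /eqP; rewrite (negPf SnT).
by rewrite ideal_prod_eq0 // annihilates_support finset.setICr.
Qed.

End Support.

(** * The triangle with three horns *)

Lemma ord3_third (i j : 'I_3) : exists2 k, i <> k & j <> k.
Proof.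
have /card_gt0P[k] : (0 < #|~: [set i; j]|%SET)%N.
  by have := cardsC [set i; j]%SET; rewrite cards2 card_ord; case: #|~: _|%SET; case: eqP.
by rewrite !inE => /norP[/eqP ki /eqP kj]; exists k; apply: nesym.
Qed.

(** The triangle consists of the singletons. The complement of [{i}] is disjoint
from [{i}] only, among the nonempty sets, so it is the horn at [i]. *)
Lemma decomposition_K33 (R : comPzRingType) (e : 'I_3 -> R) :
  decomposition e -> is_K33 (AG R).
Proof.
move=> dece; exists (fun=> unit); split=> [i|]; first exact: inhabits tt.
pose K := K33_graph (fun=> unit).
pose code (x : K) : {set 'I_3} :=
  match x with inl i => [set i]%SET | inr h => (~: [set projT1 h])%SET end.
have code_vertex x : annihilating (support_ideal e (code x)).
  apply/(annihilating_support dece); case: x => [i|[i []]] /=.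
    split; apply/eqP => /(congr1 (fun S : {set 'I_3} => #|S|)).
      by rewrite cards1 cards0.
    by rewrite cards1 cardsT card_ord.
  split; apply/eqP => /(congr1 (fun S : {set 'I_3} => #|~: S|%SET)).
    by rewrite finset.setCK cards1 finset.setC0 cardsT card_ord.
  by rewrite finset.setCK cards1 finset.setCT cards0.
have code_surj S : S != finset.set0 /\ S != [set: _]%SET -> exists x, code x = S.
  case=> Snz SnT; have S3 : (#|S| < 3)%N.
    by rewrite -[X in (_ < X)%N]card_ord -cardsT proper_card // properT.
  have S0 : (0 < #|S|)%N by rewrite card_gt0.
  have [S1|S2] : #|S| = 1%N \/ #|~: S|%SET = 1%N.
    move: (cardsC S) S0 S3; rewrite card_ord.
    by case: #|S| => [|[|[|]]] // SC _ _; [left | right; case: SC].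
  + by have /cards1P[i ->] := introT eqP S1; exists (inl i).
  + have /cards1P[i Ci] := introT eqP S2; exists (inr (existT _ i tt)).
    by rewrite /= -Ci finset.setCK.
(* The two kinds of vertices are told apart by the size of their index set. *)
have code_inj : injective code.
  have card_code x : #|code x| = if x is inl _ then 1%N else 2%N.
    case: x => [i|h] /=; first by rewrite cards1.
    by rewrite cardsC1 card_ord.
  move=> x y xy; move: (xy) (congr1 (fun S : {set 'I_3} => #|S|) xy).
  rewrite !card_code; case: x y {xy} => [i|[i []]] [j|[j []]] //= /eqP.
    by move=> /eqP/set1_inj ->.
  by rewrite (inj_eq (can_inj (@finset.setCK _))) => /eqP/set1_inj ->.
pose g (x : K) : AG R := exist _ _ (code_vertex x).
have g_inj : injective g.
  by move=> x y /(congr1 sval) /(support_ideal_inj dece) /code_inj.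
have g_surj (V : AG R) : exists x, g x = V.
  case: V => I vI; have [idI _ _] := vI.
  have [S IS] := ideal_supportP dece idI.
  have [x xS] : exists x, code x = S.
    by apply/code_surj/(annihilating_support dece); rewrite -IS.
  by exists x; apply: eq_exist; rewrite xS.
have g_adj x y : adj (g x) (g y) <-> adj x y.
  have -> : adj (g x) (g y) <-> x <> y /\ (code x :&: code y)%SET = finset.set0.
    rewrite -(annihilates_support dece) -ideal_prod_eq0;
      try exact: support_ideal_ideal.
    by split=> -[xy xy0]; split=> // E; [apply: xy; rewrite E|apply/xy/g_inj].
  have set1I0 (i : 'I_3) S : ([set i] :&: S)%SET = finset.set0 <-> i \notin S.
    by split=> [/eqP|iS]; [|apply/eqP]; rewrite setI_eq0 disjoints1.
  case: x y => [i|[i []]] [j|[j []]] /=.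
  - rewrite set1I0 inE; split=> [[_ /eqP//]|ij]; split; last exact/eqP.
    by case.
  - rewrite set1I0 !inE negbK; split=> [[_ /eqP]//|/eqP ij]; split=> //.
  - rewrite finset.setIC set1I0 !inE negbK; split=> [[_ /eqP]//|/eqP ij].
    by split.
  - split=> // -[_] /finset.setP I0.
    have [k /eqP ik /eqP jk] := ord3_third i j.
    by have := I0 k; rewrite !inE eq_sym ik eq_sym jk.
have [f fP] := choice g_surj.
exists f; split; last by move=> U V; rewrite -g_adj !fP.
by exists g => // x; apply: g_inj; rewrite fP.
Qed.

(** * From the graph to a decomposition *)

(** All that the construction of idempotents uses about the graph, stated
for ideals: [T] is the triangle and [P] picks one vertex in each horn. In
[ht_two] the ideal [V] may itself be one of the two vertices that it
annihilates; otherwise it is adjacent to both of them, and every vertex outside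
the triangle has degree one. *)
Record horned_triangle (R : comPzRingType) (T P : 'I_3 -> set R) : Prop := {
  ht_ideal : forall i, is_ideal (T i);
  ht_neq0 : forall i, T i <> [set 0];
  ht_triangle : forall i j, i <> j -> annihilates (T i) (T j);
  ht_horn : forall i j, annihilates (P i) (T j) <-> i = j;
  ht_two : forall V i j, is_ideal V -> V <> [set 0] -> i <> j ->
    annihilates V (T i) -> annihilates V (T j) -> exists k, V = T k }.

Lemma K33_horned_triangle (R : comPzRingType) :
  is_K33 (AG R) -> exists T P : 'I_3 -> set R, horned_triangle T P.
Proof.
case=> horn [horn_inh [f [[g fK gK] f_adj]]].
pose h i := inhabited_witness (horn_inh i).
have g_adj x y : adj (g x) (g y) <-> adj x y by rewrite f_adj !gK.
have idg x : is_ideal (sval (g x)) by case: (svalP (g x)).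
have nzg x : sval (g x) <> [set 0] by case: (svalP (g x)).
have annE x y : x <> y -> annihilates (sval (g x)) (sval (g y)) <-> adj x y.
  move=> xy; rewrite -g_adj -ideal_prod_eq0 //; split=> [|[]//].
  by split=> // /(can_inj gK).
exists (fun i => sval (g (inl i))), (fun i => sval (g (inr (existT _ i (h i))))).
split=> // [i j ij|i j|V i j idV Vnz ij Vi Vj].
- by apply/annE => // -[].
- by rewrite annE //=; split=> ->.
- have vV : annihilating V.
    split=> //; exists (sval (g (inl i))); split=> //.
    exact/ideal_prod_eq0.
  pose v : AG R := exist _ V vV.
  have [v_i|nvi] := pselect (v = g (inl i)).
    by exists i; rewrite -v_i.
  have [v_j|nvj] := pselect (v = g (inl j)).
    by exists j; rewrite -v_j.
  have adjV k : v <> g (inl k) -> annihilates V (sval (g (inl k))) ->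
      adj (f v) (inl k).
    by move=> nvk Vk; rewrite -g_adj fK; split=> //; apply/ideal_prod_eq0.
  have := adjV _ nvi Vi; have := adjV _ nvj Vj.
  case fv : (f v) => [k|u] /=; last by move=> <- E; case: ij.
  by move=> _ _; exists k; rewrite -fv fK.
Qed.

Section HornedTriangleRing.
Variables (R : comPzRingType) (T P : 'I_3 -> set R).
Hypothesis htTP : horned_triangle T P.

(** Otherwise the horn attached to [T i] would be adjacent to [T j]. *)
Lemma triangle_subset i j : T j `<=` T i -> j = i.
Proof.
move=> Tji; apply/esym/(ht_horn htTP) => x y Px /Tji.
by have /(ht_horn htTP) := erefl i; apply.
Qed.

(** By [ht_two] applied to the two other vertices, [K] is some [T l], and
[T l] lies in [T i] only for [l = i]. *)
Lemma triangle_minimal i K :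
  is_ideal K -> K <> [set 0] -> K `<=` T i -> K = T i.
Proof.
move=> idK Knz Ki.
have [j ij _] := ord3_third i i; have [k ik jk] := ord3_third i j.
have KT l : i <> l -> annihilates K (T l).
  by move=> il x y /Ki; apply: (ht_triangle htTP).
have [l KE] := ht_two htTP idK Knz jk (KT j ij) (KT k ik).
by rewrite KE; congr T; apply: triangle_subset; rewrite -KE.
Qed.

(** If [T i] had square zero, then [T i + T j] would annihilate [T i] and the
third vertex, hence be some [T l]; but then [l] would be both [i] and [j]. *)
Lemma triangle_square i : ~ annihilates (T i) (T i).
Proof.
move=> Ti2.
have [j ij _] := ord3_third i i; have [k ik jk] := ord3_third i j.
have idT := ht_ideal htTP.
pose V := ideal_sum (T i) (T j).
have subi : T i `<=` V by apply: ideal_sum_subl.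
have subj : T j `<=` V by apply: ideal_sum_subr.
have Vnz : V <> [set 0].
  have /(ideal_neq0P (idT i))[x Tx xnz] := @ht_neq0 _ _ _ htTP i.
  by move=> V0; apply: xnz; have := subi _ Tx; rewrite V0.
have annV l : annihilates (T i) (T l) -> annihilates (T j) (T l) ->
    annihilates V (T l).
  move=> il jl _ z [x [y [Tx Ty ->]]] Tz.
  by rewrite mulrDl il // jl // addr0.
have [||l VE] := ht_two htTP (ideal_sum_ideal (idT i) (idT j)) Vnz ik.
- by apply: annV => //; apply: (ht_triangle htTP); apply: nesym.
- by apply: annV; apply: (ht_triangle htTP).
by apply: ij; rewrite (@triangle_subset l i) -?VE // (@triangle_subset l j) -?VE.
Qed.

Lemma triangle_decomposition : exists e : 'I_3 -> R, decomposition e.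
Proof.
have idT := ht_ideal htTP.
have /choice[e eP] i : exists e, T i e /\ minimal_idempotent e.
  have [e Te mine] := brauer (idT i) (@triangle_minimal i) (@triangle_square i).
  by exists e.
have orthe i j : i <> j -> e i * e j = 0.
  by move=> ij; apply: (ht_triangle htTP ij); [case: (eP i)|case: (eP j)].
exists e; split=> //; first by move=> i; case: (eP i).
pose d := 1 - \sum_i e i.
have de i : d * e i = 0.
  rewrite mulrBl mul1r mulr_suml (bigD1 i) //= (min_idem (eP i).2) big1.
    by rewrite addr0 subrr.
  by move=> j /eqP ji; apply: orthe.
(* It remains to show [d = 0]. A nonzero [d] would generate some [T k], and [e k]
would be killed by itself. *)
apply: contrapT => se; have dnz : d <> 0.
  by move=> d0; apply: se; apply/esym/eqP; rewrite -subr_eq0; apply/eqP.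
have genT i : T i = principal (e i).
  have [Te [_ enz _]] := eP i; apply/esym/triangle_minimal => //.
  - exact: principal_ideal.
  - exact: principal_neq0.
  - by move=> _ [a ->]; have [_ _] := (is_idealP _).1 (idT i); apply.
have dT i : annihilates (principal d) (T i).
  by rewrite genT => _ _ [a ->] [b ->]; rewrite mulrACA de mulr0.
have ne : ord0 <> ord_max :> 'I_3 by [].
have [k dTk] := ht_two htTP (principal_ideal d) (principal_neq0 dnz) ne (dT _) (dT _).
have [Tek [idek enz _]] := eP k.
by apply: enz; rewrite -idek; apply: (dT k) => //; rewrite dTk.
Qed.

End HornedTriangleRing.

Theorem theorem4p7 (R : comPzRingType) :
  is_K33 (AG R) <->
  exists F1 F2 F3 : fieldType, ring_iso R (F1 * F2 * F3)%type.
Proof.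
split=> [/K33_horned_triangle[T [P htTP]]|[F1 [F2 [F3 isoR]]]].
  have [e dece] := triangle_decomposition htTP.
  exact: ring_iso_corners dece.
have [E decE] := decomposition_fields F1 F2 F3.
have [e dece] := decomposition_iso isoR decE.
exact: decomposition_K33 dece.
Qed.
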